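(* Let $\Pi_{\mathcal A}=\{1324,1342,2413,2431,3124,3142,4213,4231\}$ and $\Pi_{\mathcal S}=\{1243,1423,2143,4123,2413,4213,2431,4231\}$. Then for all $n\ge 0$, $$Q_n(\Pi_{\mathcal S})=Q_n(\Pi_{\mathcal A}).$$
   Context: $\mathfrak{S}_n$ is the set of permutations of $[n]$ in one-line notation. A permutation $\sigma$ contains $\pi$ as a pattern if some (not necessarily consecutive) subsequence of $\sigma$ is order-isomorphic to $\pi$; otherwise it avoids $\pi$. $\mathfrak{S}_n(\Pi)$ is the set of $\sigma\in\mathfrak{S}_n$ avoiding every $\pi\in\Pi$. $\mathrm{Des}\,\sigma=\{i\mid\sigma_i>\sigma_{i+1}\}\subseteq[n-1]$. For $S\subseteq[n-1]$, $F_S=\sum x_{i_1}\cdots x_{i_n}$ over all $i_1\le\dots\le i_n$ with $i_s<i_{s+1}$ whenever $s\in S$. $Q_n(\Pi)=\sum_{\sigma\in\mathfrak{S}_n(\Pi)}F_{\mathrm{Des}\,\sigma}$. (The elements of $\mathfrak{S}_n(\Pi_{\mathcal A})$ are the arc permutations: those for which every prefix is an interval in the integers modulo $n$. The set $\Pi_{\mathcal S}$ is the set of permutations in $\mathfrak S_4$ in which $1$ is inserted in an arbitrary position of $243$ or of $423$, i.e. the shuffle of $\{1\}$ with $\{132,312\}$.) *)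

(* Defs.v *)
From mathcomp Require Import all_boot all_fingroup all_algebra.
From mathcomp Require Import finmap monalg.

Set Implicit Arguments.
Unset Strict Implicit.
Unset Printing Implicit Defensive.

Local Open Scope nat_scope.

(* [n] is encoded as 'I_n, so the letters of a permutation are shifted by one
   to obtain its one-line notation s_1 s_2 ... s_n. *)
Definition one_line n (s : 'S_n) : seq nat := [seq (s i).+1 | i <- enum 'I_n].

Definition order_iso (u v : seq nat) : bool :=
  (size u == size v) &&
  [forall i : 'I_(size u), forall j : 'I_(size u),
     (nth 0 u i < nth 0 u j) == (nth 0 v i < nth 0 v j)].

(* The subsequences of w are the words mask b w, for b a bit vector of the
   same length as w. *)
Definition contains (w p : seq nat) : bool :=
  [exists b : (size w).-tuple bool, order_iso (mask b w) p].

(* Patterns are given in one-line notation. *)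
Definition avoiders n (Pi : seq (seq nat)) : {set 'S_n} :=
  [set s | all (fun p => ~~ contains (one_line s) p) Pi].

(* [n-1] is encoded as 'I_n.-1: the ordinal i stands for the position i + 1,
   and letters at positions i + 1, i + 2 have 0-based indices i, i.+1. *)
Definition Des n (s : 'S_n) : {set 'I_n.-1} :=
  [set i : 'I_n.-1 | nth 0 (one_line s) i.+1 < nth 0 (one_line s) i].

(* Formal power series over the integers in countably many commuting
   variables x_0, x_1, ...: families of coefficients indexed by monomials. *)
Definition power_series := {cmonom nat} -> int.

Definition monomial_of (t : seq nat) : {cmonom nat} :=
  \big[mmul/mone]_(i <- t) ucm i.

Definition admissible n (S : {set 'I_n.-1}) (t : seq nat) : bool :=
  sorted leq t && [forall i : 'I_n.-1 in S, nth 0 t i < nth 0 t i.+1].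

(* The coefficient of m in F_S is the number of admissible index words
   t = (i_1, ..., i_n) with x_{i_1} ... x_{i_n} = m.  Every such word has its
   letters in the finite support of m (see monomial_of_finsupp below), hence
   it is enough to count words over that support. *)
Definition F n (S : {set 'I_n.-1}) : power_series := fun m =>
  Posz #|[set t : n.-tuple (finsupp m) |
            admissible S [seq val x | x <- t] &&
            (monomial_of [seq val x | x <- t] == m)]|.

Lemma monomial_of_finsupp (t : seq nat) (m : {cmonom nat}) :
  monomial_of t = m -> {subset t <= finsupp m}.
Proof.
move=> <- {m}; elim: t => [|a t IH] x //.
rewrite /monomial_of big_cons mdomD in_fsetU in_cons => /orP[/eqP->|xt].
  by rewrite mdomU in_fset1 eqxx.
by rewrite IH ?orbT.
Qed.

Definition Q n (Pi : seq (seq nat)) : power_series := fun m =>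
  (\sum_(s in avoiders n Pi) F (Des s) m)%R.

Definition Pi_A : seq (seq nat) :=
  [:: [:: 1; 3; 2; 4]; [:: 1; 3; 4; 2]; [:: 2; 4; 1; 3]; [:: 2; 4; 3; 1];
      [:: 3; 1; 2; 4]; [:: 3; 1; 4; 2]; [:: 4; 2; 1; 3]; [:: 4; 2; 3; 1]].

Definition Pi_S : seq (seq nat) :=
  [:: [:: 1; 2; 4; 3]; [:: 1; 4; 2; 3]; [:: 2; 1; 4; 3]; [:: 4; 1; 2; 3];
      [:: 2; 4; 1; 3]; [:: 4; 2; 1; 3]; [:: 2; 4; 3; 1]; [:: 4; 2; 3; 1]].

(* Main.v *)
(* Both sides expand in the F_D, so the claim is that for each descent set D the
   two avoidance classes contain equally many permutations with descent set D.
   A permutation is determined by the comparisons r(i,k) = [s_i < s_k], i < k,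
   and any r for which r(i,j) = r(j,k) forces r(i,k) arises in this way.

   Avoiding Pi_A means that for i < j the value of r(i,k) (+) r(j,k) does not
   depend on k > j, i.e. r(i,k) = e_i (+) c_k with e_i = r(i,L), L the last
   position; transitivity then forces c to vanish after the first change of e.
   Given the ascents a_i = e_i (+) c_{i+1}, the only freedom is the place of that
   first change: nowhere, or at a q with a_q <> a_{q+1}.

   Avoiding Pi_S means that away from the smallest letter, at position p, r(i,k)
   depends on k only, hence is a_{k-1}, except for a free bit b when k = p+1 and
   p is an interior position; p must be a valley of a.

   The two counts agree since the numbers of changes of a from 0 to 1 and from
   1 to 0 differ only by boundary terms. *)
Require Import Defs.
From Stdlib Require Import FunctionalExtensionality.
From mathcomp Require Import all_boot all_fingroup all_algebra zify.

Set Implicit Arguments.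
Unset Strict Implicit.
Unset Printing Implicit Defensive.

Local Open Scope nat_scope.

(** * Avoidance of patterns of length four *)

Lemma contains4P (w p : seq nat) : size p = 4 ->
  reflect (exists i j k l, [/\ i < j < k, k < l < size w &
             order_iso [:: nth 0 w i; nth 0 w j; nth 0 w k; nth 0 w l] p])
          (contains w p).
Proof.
move=> sp; apply: (iffP existsP) => [[b]|[i [j [k [l [ijk klw iso]]]]]].
  have {2}-> : w = map (nth 0 w) (iota 0 (size w)) by rewrite map_nth_iota0 ?take_size.
  rewrite -map_mask; set u := mask b _ => iso.
  have su : size u = 4 by case/andP: iso => /eqP; rewrite size_map sp.
  have uw x : x \in u -> x < size w.
    by move/mem_mask; rewrite mem_iota.
  have: sorted ltn u by apply: sorted_mask (iota_ltn_sorted _ _); exact: ltn_trans.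
  move: uw iso; case: u su => [|i [|j [|k [|l [|? ?]]]]] // _ uw iso.
  move=> /= /and4P[ij jk kl _]; exists i, j, k, l.
  by rewrite ij jk kl uw // !inE eqxx !orbT.
pose u := [:: i; j; k; l].
have tP : size [seq x \in u | x <- iota 0 (size w)] == size w.
  by rewrite size_map size_iota.
exists (Tuple tP) => /=.
have {2}-> : w = map (nth 0 w) (iota 0 (size w)) by rewrite map_nth_iota0 ?take_size.
rewrite -map_mask -filter_mask; suff -> : [seq x <- iota 0 (size w) | x \in u] = u by [].
apply: (irr_sorted_eq ltn_trans ltnn).
- by apply: sorted_filter (iota_ltn_sorted _ _); exact: ltn_trans.
- by rewrite /= !andbT; lia.
- by move=> x; rewrite mem_filter mem_iota !inE; lia.
Qed.

(** With list quantifiers, order isomorphism to an explicit pattern computes to a Boolean formula in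
    the comparisons. *)
Lemma order_isoE (u v : seq nat) : order_iso u v =
  (size u == size v) &&
  all (fun i => all (fun j => (nth 0 u i < nth 0 u j) == (nth 0 v i < nth 0 v j))
                    (iota 0 (size u))) (iota 0 (size u)).
Proof.
congr andb; apply/idP/idP.
  move=> /forallP H; apply/allP => i; rewrite mem_iota /= => iu.
  apply/allP => j; rewrite mem_iota /= => ju.
  exact: (forallP (H (Ordinal iu)) (Ordinal ju)).
move=> /allP H; apply/forallP => i; apply/forallP => j.
by apply: (allP (H i _)); rewrite mem_iota /=.
Qed.

(* Positions are counted from 0, letters from 1. *)
Definition letter n (s : 'S_n) (i : nat) := nth 0 (one_line s) i.

Lemma letterE n (s : 'S_n) (i : 'I_n) : letter s i = (s i).+1.
Proof. by rewrite /letter /one_line (nth_map i) ?size_enum_ord // nth_ord_enum. Qed.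

Lemma size_one_line n (s : 'S_n) : size (one_line s) = n.
Proof. by rewrite size_map size_enum_ord. Qed.

Lemma letter_neq n (s : 'S_n) i j : i < j < n -> letter s i != letter s j.
Proof.
case/andP=> ij jn; have i_n := ltn_trans ij jn.
rewrite (letterE s (Ordinal i_n)) (letterE s (Ordinal jn)) eqSS.
by apply/eqP => /val_inj /perm_inj [] E; rewrite E ltnn in ij.
Qed.

Lemma letters4_neq n (s : 'S_n) i j k l : i < j < k -> k < l < n ->
  (letter s i != letter s j) * (letter s i != letter s k) * (letter s i != letter s l)
  * (letter s j != letter s k) * (letter s j != letter s l) * (letter s k != letter s l).
Proof. by move=> ijk kln; do !split; apply: letter_neq; lia. Qed.

Lemma avoidersP n (Pi : seq (seq nat)) (s : 'S_n) : all (fun p => size p == 4) Pi ->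
  reflect (forall i j k l, i < j < k -> k < l < n ->
      all (fun p => ~~ order_iso [:: letter s i; letter s j; letter s k; letter s l] p) Pi)
    (s \in avoiders n Pi).
Proof.
move=> /allP s4; rewrite inE; apply: (iffP allP) => H.
  move=> i j k l ijk kln; apply/allP => p pPi.
  apply: contra (H p pPi) => iso; apply/contains4P; first exact/eqP/s4.
  by exists i, j, k, l; rewrite size_one_line.
move=> p pPi; apply/negP => /(contains4P _ (eqP (s4 p pPi))).
case=> i [j [k [l []]]]; rewrite size_one_line => ijk kln.
by apply/negP; exact: (allP (H i j k l ijk kln)).
Qed.

(** The eight patterns are exactly those in which one of the last two letters, but not both, lies in
    value between the first two. *)
Lemma avoiders_AP n (s : 'S_n) :
  reflect (forall i j k l, i < j < k -> k < l < n ->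
             (letter s i < letter s k) (+) (letter s j < letter s k)
             = (letter s i < letter s l) (+) (letter s j < letter s l))
    (s \in avoiders n Pi_A).
Proof.
have main i j k l : i < j < k -> k < l < n ->
  all (fun p => ~~ order_iso [:: letter s i; letter s j; letter s k; letter s l] p) Pi_A
   = ((letter s i < letter s k) (+) (letter s j < letter s k)
      == (letter s i < letter s l) (+) (letter s j < letter s l)).
  move=> ijk kln; have := letters4_neq s ijk kln.
  move: (letter s i) (letter s j) (letter s k) (letter s l) => a b c d.
  case=> [[[[[ab ac] ad] bc] bd] cd].
  rewrite /= !order_isoE /= !ltnn.
  by case: (ltngtP a b) ab => //; case: (ltngtP a c) ac => //; case: (ltngtP a d) ad => //;
   case: (ltngtP b c) bc => //; case: (ltngtP b d) bd => //; case: (ltngtP c d) cd => //=; lia.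
apply: (iffP (avoidersP _ _)) => // H i j k l ijk kln.
  by apply/eqP; rewrite -main //; exact: H.
by rewrite main //; apply/eqP; exact: H.
Qed.

(** Removing the 1 from a pattern of [Pi_S] leaves three letters, the last between the other two in
    value; [m] is the place of the letter playing that 1. *)
Lemma avoiders_SP n (s : 'S_n) :
  reflect (forall i j k m, i < j < k -> k < n -> m < n ->
             letter s m < letter s i -> letter s m < letter s j -> letter s m < letter s k ->
             (letter s i < letter s k) = (letter s j < letter s k))
    (s \in avoiders n Pi_S).
Proof.
pose lowest x y z t := [&& x < y, x < z & x < t].
have main i j k l : i < j < k -> k < l < n ->
  let a := letter s i in let b := letter s j in
  let c := letter s k in let d := letter s l in
  all (fun p => ~~ order_iso [:: a; b; c; d] p) Pi_S
   = [&& lowest a b c d ==> ((b < d) == (c < d)), lowest b a c d ==> ((a < d) == (c < d)),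
         lowest c a b d ==> ((a < d) == (b < d)) & lowest d a b c ==> ((a < c) == (b < c))].
  move=> ijk kln; have := letters4_neq s ijk kln.
  move: (letter s i) (letter s j) (letter s k) (letter s l) => a b c d.
  case=> [[[[[ab ac] ad] bc] bd] cd].
  rewrite /lowest /= !order_isoE /= !ltnn.
  by case: (ltngtP a b) ab => //; case: (ltngtP a c) ac => //; case: (ltngtP a d) ad => //;
   case: (ltngtP b c) bc => //; case: (ltngtP b d) bd => //; case: (ltngtP c d) cd => //=; lia.
apply: (iffP (avoidersP _ _)) => // H.
  have {}H i j k l ijk kln := etrans (esym (main i j k l ijk kln)) (H i j k l ijk kln).
  move=> i j k m ijk kn mn mi mj mk.
  have [mlti|iltm|mi_eq] := ltngtP m i; last by rewrite mi_eq ltnn in mi.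
    case/and4P: (H m i j k ltac:(lia) ltac:(lia)) => /implyP + _ _ _.
    by rewrite /lowest mi mj mk => /(_ isT)/eqP.
  have [mltj|jltm|mj_eq] := ltngtP m j; last by rewrite mj_eq ltnn in mj.
    case/and4P: (H i m j k ltac:(lia) ltac:(lia)) => _ /implyP + _ _.
    by rewrite /lowest mi mj mk => /(_ isT)/eqP.
  have [mltk|kltm|mk_eq] := ltngtP m k; last by rewrite mk_eq ltnn in mk.
    case/and4P: (H i j m k ltac:(lia) ltac:(lia)) => _ _ /implyP + _.
    by rewrite /lowest mi mj mk => /(_ isT)/eqP.
  case/and4P: (H i j k m ltac:(lia) ltac:(lia)) => _ _ _ /implyP.
  by rewrite /lowest mi mj mk => /(_ isT)/eqP.
move=> i j k l ijk kln; rewrite main //.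
apply/and4P; split; apply/implyP => /and3P[? ? ?]; apply/eqP.
- by apply: (H j k l i) => //; lia.
- by apply: (H i k l j) => //; lia.
- by apply: (H i j l k) => //; lia.
- by apply: (H i j k l) => //; lia.
Qed.

(** * Permutations from their comparisons *)

Definition order_data n (s : 'S_n) (r : nat -> nat -> bool) : bool :=
  [forall i : 'I_n, forall k : 'I_n, (i < k) ==> ((letter s i < letter s k) == r i k)].

Lemma order_dataP n (s : 'S_n) r :
  reflect (forall i k, i < k < n -> (letter s i < letter s k) = r i k) (order_data s r).
Proof.
apply: (iffP forallP) => H.
  move=> i k /andP[ik kn]; have i_n := ltn_trans ik kn.
  by have /forallP/(_ (Ordinal kn))/implyP/(_ ik)/eqP := H (Ordinal i_n).
move=> i; apply/forallP => k; apply/implyP => ik; apply/eqP/H.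
by rewrite ik ltn_ord.
Qed.

Lemma card_lt_perm n (s : 'S_n) (i : 'I_n) : #|[set j | s j < s i]| = s i.
Proof.
have -> : [set j | s j < s i] = s @^-1: [set k : 'I_n | k < s i].
  by apply/setP => j; rewrite !inE.
rewrite card_preimset; last exact: perm_inj.
rewrite cardsE cardE /enum_mem -enumT -(size_map val).
rewrite -(filter_map val (fun x => x < s i)) val_enum_ord.
rewrite -{2}(size_iota 0 (s i)); congr size.
apply: (irr_sorted_eq ltn_trans ltnn).
- by apply: sorted_filter (iota_ltn_sorted _ _); exact: ltn_trans.
- exact: iota_ltn_sorted.
- by move=> x; rewrite mem_filter !mem_iota; have := ltn_ord (s i); lia.
Qed.

(** Each value is the number of smaller values, hence is read off from the comparisons. *)
Lemma order_data_inj n (s t : 'S_n) r : order_data s r -> order_data t r -> s = t.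
Proof.
move=> /order_dataP sr /order_dataP tr; apply/permP => i; apply/val_inj.
rewrite /= -card_lt_perm -(card_lt_perm t); congr #|pred_of_set _|; apply/setP => j.
rewrite !inE -ltnS -[RHS]ltnS -!letterE.
have [ij|ji|/val_inj->] := ltngtP i j; last by rewrite !ltnn.
  have ijn : i < j < n by rewrite ij ltn_ord.
  have := letter_neq s ijn; have := letter_neq t ijn.
  by have := sr i j ijn; have := tr i j ijn; lia.
have jin : j < i < n by rewrite ji ltn_ord.
by rewrite sr // tr.
Qed.

(* The hypothesis says that extending [r] to pairs with i > k by antisymmetry
   gives a transitive relation; the rank function of this total order is the
   permutation. *)
Lemma order_data_exists n (r : nat -> nat -> bool) :
  (forall i j k, i < j < k -> k < n -> r i j = r j k -> r i k = r i j) ->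
  exists s : 'S_n, order_data s r.
Proof.
move=> r_tr.
pose lt (i j : nat) := if i < j then r i j else (j < i) && ~~ r j i.
have lt_irr i : lt i i = false by rewrite /lt ltnn.
have lt_tot i j : i != j -> lt j i = ~~ lt i j.
  by rewrite /lt; case: ltngtP => // _ _; rewrite ?negbK.
have lt_tr (i j k : 'I_n) : lt i j -> lt j k -> lt i k.
  have [->|ik] := eqVneq i k.
    by have [->//|/lt_tot->] := eqVneq j k; move/negP.
  have [->//|ij] := eqVneq i j; have [->//|jk] := eqVneq j k.
  (* One instance of [r_tr] for each ordering of the three positions. *)
  have := (r_tr i j k, r_tr i k j, r_tr j i k, r_tr j k i, r_tr k i j, r_tr k j i).
  case=> -[[[[]]]]; have [i_n [jn kn]] := (ltn_ord i, (ltn_ord j, ltn_ord k)).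
  rewrite /lt {}jn {}kn {}i_n; move: ij jk ik; rewrite -!(inj_eq val_inj) /=.
  case: (ltngtP i j) => // ij _; case: (ltngtP j k) => // jk _;
    case: (ltngtP i k) => //= ik _; lia.
pose rank (i : 'I_n) := #|[set j : 'I_n | lt j i]|.
have rank_lt i : rank i < n.
  rewrite -[X in _ < X]card_ord -cardsT; apply: proper_card.
  by apply/properP; split; [exact: subsetT|exists i; rewrite !inE ?lt_irr].
have rank_mono (i k : 'I_n) : lt i k -> rank i < rank k.
  move=> ik; apply: proper_card; apply/properP; split.
    by apply/subsetP => j; rewrite !inE => ji; exact: lt_tr ji ik.
  by exists i; rewrite !inE ?lt_irr.
have rank_inj : injective (fun i => Ordinal (rank_lt i)).
  move=> i k /(congr1 val)/= Eik; apply/eqP; apply: contraT => ik.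
  have := lt_tot i k ik; case E: (lt i k) => /= ki.
    by have := rank_mono i k E; rewrite Eik ltnn.
  by have := rank_mono k i ki; rewrite Eik ltnn.
exists (perm rank_inj); apply/order_dataP => i k /andP[ik kn].
have i_n := ltn_trans ik kn.
rewrite (letterE _ (Ordinal i_n)) (letterE _ (Ordinal kn)) !permE /= ltnS.
have := rank_mono (Ordinal i_n) (Ordinal kn); have := rank_mono (Ordinal kn) (Ordinal i_n).
rewrite /lt /= ik ltnNge ltnW //=; case: (r i k) => /= [_ ->//|/(_ isT) ki _].
by apply/negbTE; rewrite -leqNgt ltnW.
Qed.

(** Comparisons determine a permutation, so choosing one for each parameter is a bijection onto [B];
    the default [1%g] is never reached on [V]. *)
Lemma card_parametrized n (B : {set 'S_n}) (T : finType) (V : {set T})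
    (r : T -> nat -> nat -> bool) :
  (forall v, v \in V -> exists2 s, s \in B & order_data s (r v)) ->
  (forall s, s \in B -> exists2 v, v \in V & order_data s (r v)) ->
  (forall v w, v \in V -> w \in V ->
     (forall i k, i < k < n -> r v i k = r w i k) -> v = w) ->
  #|B| = #|V|.
Proof.
move=> VB BV r_inj; pose G v := odflt 1%g [pick s in B | order_data s (r v)].
have GP v : v \in V -> G v \in B /\ order_data (G v) (r v).
  move=> /VB[s sB sr]; rewrite /G; case: pickP => [t /andP[]//|/(_ s)].
  by rewrite sB sr.
rewrite -(card_in_imset (f := G) (D := V)); last first.
  move=> v w vV wV Gvw; apply: r_inj => // i k ik.
  have [[_ /order_dataP vr] [_ /order_dataP wr]] := (GP v vV, GP w wV).
  by rewrite -vr // Gvw wr.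
apply: eq_card => s; apply/idP/imsetP => [sB|[v vV ->]]; last by case: (GP v vV).
have [v vV sv] := BV s sB; exists v => //.
by have [_ Gv] := GP v vV; exact: order_data_inj sv Gv.
Qed.

(** * Descents and changes of the ascent sequence *)

Lemma DesP l (s : 'S_l.+2) (D : {set 'I_l.+1}) :
  reflect (forall i, i < l.+1 -> (letter s i < letter s i.+1) = (inord i \notin D))
    (Des s == D).
Proof.
apply: (iffP eqP) => [<- i il|H].
  rewrite inE inordK // -/(letter s _) -/(letter s _).
  have iil : i < i.+1 < l.+2 by lia.
  by have := letter_neq s iil; lia.
apply/setP => i; rewrite inE -/(letter s _) -/(letter s _).
have iil : i < i.+1 < l.+2 by have := ltn_ord i; lia.
have := letter_neq s iil; have := H i (ltn_ord i).
by rewrite inord_val; case: (i \in D) => /=; lia.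
Qed.

(** Rises minus falls of [a] telescope to a_l - a_0, so the changes number twice the rises plus a_0
    - a_l. *)
Lemma count_changes l (a : nat -> bool) :
  (\sum_(q < l) (a q != a q.+1)).+1
  = a 0 + ~~ a l + (\sum_(q < l) (~~ a q && a q.+1)).*2.
Proof.
elim: l => [|l IH]; first by rewrite !big_ord0; case: (a 0).
rewrite !big_ord_recr /= -addSn IH.
by case: (a l); case: (a l.+1); case: (a 0) => /=; lia.
Qed.

Lemma first_change (e : nat -> bool) l :
  exists q, [/\ q <= l, (q == l) || (e q != e q.+1) & forall i, i <= q -> e i = e q].
Proof.
elim: l => [|l [q [ql qV e_q]]]; first by exists 0; split=> // i; rewrite leqn0 => /eqP->.
case/predU1P: qV => [Eq|e_qq]; last by exists q; rewrite e_qq orbT leqW.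
have [e_l|e_l] := eqVneq (e l) (e l.+1); last first.
  by exists q; rewrite leqW // Eq e_l orbT; split=> // i; rewrite -Eq; exact: e_q.
exists l.+1; rewrite eqxx; split=> // i; rewrite leq_eqVlt => /predU1P[->//|il].
by rewrite e_q ?Eq.
Qed.

(** * Avoiders of [Pi_A] with a given descent set *)

(* [a] is the sequence of ascents and [q] the first place where e changes, so that
   e_i = a_(max i q) and c_k = a_(k-1) (+) e_(k-1); [q] is the last index of [a]
   when e is constant. *)
Definition arc_order (a : nat -> bool) (q i k : nat) : bool :=
  a (maxn i q) (+) a k.-1 (+) a (maxn k.-1 q).

Lemma card_avoiders_A l (D : {set 'I_l.+1}) (a := fun i => inord i \notin D) :
  #|[set s in avoiders l.+2 Pi_A | Des s == D]| = (\sum_(q < l) (a q != a q.+1)).+1.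
Proof.
pose V := [set q : 'I_l.+1 | (q == l :> nat) || (a q != a q.+1)].
transitivity #|V|; last first.
  (* The index q = l is always allowed and gives the unit. *)
  rewrite -sum1dep_card big_mkcond big_ord_recr /= eqxx addn1; congr _.+1.
  by apply: eq_bigr => q _; rewrite (ltn_eqF (ltn_ord q)) /=; case: ifP.
apply: (card_parametrized (r := fun q : 'I_l.+1 => arc_order a q)).
- move=> q; rewrite inE => qV.
  have [|s sr] := @order_data_exists l.+2 (arc_order a q).
    move=> i j k /andP[ij jk] kl; rewrite /arc_order.
    (* If j <= q, then e_i = e_j and r(i,k) = r(j,k); otherwise c_j and c_k vanish and r(i,j) =
       r(i,k) = e_i. *)
    case: (boolP (j <= q)) => [jq|qj].
      have [-> ->] : maxn i q = q /\ maxn j q = q by lia.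
      by have -> : maxn j.-1 q = q by lia; rewrite addbb.
    have -> : maxn k.-1 q = k.-1 by lia.
    have -> : maxn j.-1 q = j.-1 by lia.
    by rewrite -!addbA !addbb.
  exists s => //; move/order_dataP: sr => sr.
  rewrite inE; apply/andP; split.
    apply/avoiders_AP => i j k m ijk kml; rewrite !sr; try lia.
    rewrite /arc_order.
    by move: (a (maxn i q)) (a (maxn j q)) (a k.-1) (a m.-1) (a (maxn k.-1 q))
      (a (maxn m.-1 q)) => [] [] [] [] [] [].
  apply/DesP => i il; rewrite sr ?ltnSn // /arc_order /= -/(a i).
  by rewrite addbC addbA addbb.
- move=> s; rewrite inE => /andP[/avoiders_AP sA /DesP sD].
  pose e i := letter s i < letter s l.+1.
  have e_last : e l = a l by rewrite /e sD.
  have [q [ql qV e_q]] := first_change e l.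
  (* The last letter separates the two letters in value. *)
  have e_order i j : e i != e j -> (letter s i < letter s j) = e i.
    by rewrite /e; lia.
  have e_asc i : q <= i <= l -> e i = a i.
    case/andP=> qi; rewrite leq_eqVlt => /predU1P[->//|il].
    rewrite /a -sD; last exact: leqW.
    have [e_i|] := eqVneq (e i) (e i.+1); last by move/e_order->; lia.
    (* Of q and q+1, where e differs, one differs from e_i. Avoidance at i0, i, i+1 and the last
       position then gives a_i = e_i. *)
    have [i0 i0i e_i0] : exists2 i0, i0 < i & e i0 != e i.
      case/predU1P: qV => [E|qV]; first lia.
      have [E|e_qi] := eqVneq (e q) (e i).
        exists q.+1; last by rewrite -E eq_sym.
        rewrite ltn_neqAle; apply/andP; split; last first.
          by rewrite ltn_neqAle qi andbT; apply: contraNneq qV => ->; apply/eqP.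
        by apply: contraNneq qV => ->; apply/eqP.
      exists q => //; rewrite ltn_neqAle qi andbT.
      by apply: contraNneq e_qi => ->.
    have := sA i0 i i.+1 l.+1; rewrite (e_order i0 i.+1) -?e_i //.
    rewrite -/(e i0) -/(e i) => /(_ ltac:(lia) ltac:(lia)).
    by move: e_i0; case: (e i0); case: (e i); case: (_ < _).
  have e_max j : j <= l -> e j = a (maxn j q).
    move=> jl; case: (leqP j q) => [jq|qj]; last by rewrite e_asc // (ltnW qj).
    by rewrite e_q // e_asc ?leqnn.
  exists (Ordinal (ql : q < l.+1)).
    rewrite inE /=; have [//|ql'] := eqVneq q l.
    by move: qV; rewrite (negbTE ql') /= !e_asc //; lia.
  apply/order_dataP => i k /andP[ik kl]; rewrite /arc_order.
  have il : i <= l by rewrite -ltnS (leq_trans ik).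
  have [->|k_l] := eqVneq k l.+1.
    rewrite -/(e i) (e_max _ il) /= (maxn_idPl ql).
    by rewrite -addbA addbb addbF.
  rewrite -!e_max; [|lia..].
  have [ik1|ik1] := eqVneq i k.-1.
    have -> : k = i.+1 by lia.
    by rewrite sD -/(a i) /=; [rewrite addbC addbA addbb|lia].
  (* This yields r(i,k) = e_i (+) e_{k-1} (+) a_{k-1}. *)
  have := sA i k.-1 k l.+1; rewrite -/(e i) -/(e k.-1) => /(_ ltac:(lia) ltac:(lia)).
  have -> : (letter s k.-1 < letter s k) = a k.-1.
    by rewrite -[in letter s k](ltn_predK ik) sD //; lia.
  by move: (_ < _) (e i) (e k.-1) (a k.-1) => [] [] [] [].
- move=> v w; rewrite !inE => vV wV H.
  have {}H i : i < l.+1 -> a (maxn i v) = a (maxn i w).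
    move=> il; have := H i l.+1; rewrite /arc_order /= il ltnSn => /(_ isT).
    have := (ltn_ord v, ltn_ord w) => -[vl wl].
    by rewrite (maxn_idPl (_ : v <= l)) // (maxn_idPl (_ : w <= l)) // -!addbA !addbb !addbF.
  have vl (v' : 'I_l.+1) : v' < l.+1 := ltn_ord v'.
  wlog vw : v w vV wV H / v < w.
    move=> wlog_vw; apply/val_inj; case: (ltngtP v w) => // vw.
      by rewrite (wlog_vw v w).
    by rewrite (wlog_vw w v) // => i il; rewrite H.
  have wl := vl w; move: vV; have -> : (v == l :> nat) = false by lia.
  (* At v and v+1 the side of w takes the same value a_w, so a does not change at v, against the
     choice of v. *)
  have := (H v, H v.+1) => -[]; have -> : maxn v v = v by lia.
  have -> : maxn v.+1 v = v.+1 by lia.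
  have [-> ->] : maxn v w = w /\ maxn v.+1 w = w by lia.
  by rewrite (vl v) => -> // ->; [rewrite eqxx|lia].
Qed.

(** * Avoiders of [Pi_S] with a given descent set *)

(* [pb.1] is the position of the smallest letter; [pb.2] compares the letters on
   its two sides, and is fixed to [false] below when one of them is missing. *)
Definition low_insertion_order (a : nat -> bool) (pb : nat * bool) (i k : nat) : bool :=
  (k != pb.1) && ((i == pb.1) || (if k == pb.1.+1 then pb.2 else a k.-1)).

Lemma card_avoiders_S l (D : {set 'I_l.+1}) (a := fun i => inord i \notin D) :
  #|[set s in avoiders l.+2 Pi_S | Des s == D]|
  = a 0 + ~~ a l + (\sum_(q < l) (~~ a q && a q.+1)).*2.
Proof.
pose valid (p : nat) (b : bool) := [&& (p == 0) || ~~ a p.-1, (p == l.+1) || a p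
  & (0 < p < l.+1) || ~~ b].
pose V := [set pb : 'I_l.+2 * bool | valid pb.1 pb.2].
transitivity #|V|; last first.
  rewrite -sum1dep_card big_mkcond /=.
  rewrite -(pair_bigA _ (fun (p : 'I_l.+2) b => if valid p b then 1 else 0)) /=.
  rewrite (eq_bigr (fun p : 'I_l.+2 => valid p true + valid p false)); last first.
    by move=> p _; rewrite big_bool; do 2 case: (valid _ _).
  (* The two end positions give a_0 and the negation of a_l; an interior p = q+1 counts twice, once
     for each bit. *)
  rewrite big_ord_recl big_ord_recr /= /valid /bump /= !ltnn !eqxx /= !andbT !andbF.
  rewrite !add0n -!addnA; congr (_ + _); rewrite addnC; congr (_ + _).
  rewrite -muln2 big_distrl /=; apply: eq_bigr => q _.
  rewrite !add0n !add1n ltnS ltn_ord eqSS (ltn_eqF (ltn_ord q)) /= !andbT.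
  by case: (_ && _).
apply: (card_parametrized (r := fun pb : 'I_l.+2 * bool =>
                                  low_insertion_order a (val pb.1, pb.2))).
- case=> p b; rewrite inE /= => /and3P[p0 pl _].
  have [|s sr] := @order_data_exists l.+2 (low_insertion_order a (val p, b)).
    move=> i j k; rewrite /low_insertion_order /=.
    case: eqP; case: eqP; case: eqP; case: eqP => //=; lia.
  exists s => //; move/order_dataP: sr => sr.
  rewrite inE; apply/andP; split.
    apply/avoiders_SP => i j k m ijk kl ml mi mj mk.
    have p_min t : t < l.+2 -> letter s m < letter s t -> t != p.
      move=> tl mt; apply: contraTneq mt => ->; rewrite -leqNgt.
      have [pm|mp|->//] := ltngtP p m.
        have pml : p < m < l.+2 by rewrite pm ml.
        by rewrite ltnW // sr // /low_insertion_order /= eqxx (gtn_eqF pm).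
      have mpl : m < p < l.+2 by rewrite mp ltn_ord.
      by rewrite leqNgt sr // /low_insertion_order /= eqxx.
    have [ip jp] : i != p /\ j != p by split; apply: p_min => //; lia.
    by rewrite !sr; [rewrite /low_insertion_order /= (negbTE ip) (negbTE jp)|lia..].
  apply/DesP => i il; rewrite sr ?ltnSn // -/(a i) /low_insertion_order /= eqSS.
  move: p0 pl; have [<-|ip] := eqVneq i.+1 p; first by move=> /negbTE->.
  have [i_p|//] := eqVneq i p; rewrite -i_p => _.
  by have -> : (i == l.+1) = false by lia.
- move=> s; rewrite inE => /andP[/avoiders_SP sA /DesP sD].
  pose p := (s^-1)%g ord0.
  have p_min t : t < l.+2 -> t != p -> letter s p < letter s t.
    move=> tl tp; rewrite letterE (letterE s (Ordinal tl)) permKV ltnS lt0n.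
    apply: contraNneq tp => st.
    suff -> : p = Ordinal tl by [].
    by rewrite /p -[RHS](permK s); congr (_ _); apply/val_inj; rewrite /= st.
  have pl := ltn_ord p.
  (* By avoidance, position 0 represents all positions before p. *)
  pose b := (0 < p < l.+1) && (letter s 0 < letter s p.+1).
  exists (p, b).
    rewrite inE /= /valid /b; apply/and3P; split; last by case: (_ < _ < _).
      have [//|p0] := eqVneq (p : nat) 0.
      have := p_min p.-1; have := sD p.-1; rewrite -/(a _) prednK ?lt0n //; lia.
    have [//|p_l] := eqVneq (p : nat) l.+1.
    have := p_min p.+1; have := sD p; rewrite -/(a _) /=; lia.
  apply/order_dataP => i k /andP[ik kl]; rewrite /low_insertion_order /=.
  have [k_p|k_p] := eqVneq k p.
    by have := p_min i; rewrite k_p; lia.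
  have [->|i_p] := eqVneq i p; first by rewrite p_min.
  have [k_p1|k_p1] := eqVneq k p.+1.
    have -> : b = (letter s 0 < letter s k) by rewrite /b k_p1; lia.
    have [->//|i0] := posnP i.
    by rewrite (sA 0 i k p) ?p_min ?i0 //=; lia.
  have [->|i_k] := eqVneq i k.-1.
    by have := sD k.-1; rewrite prednK -/(a _) => [->|]; lia.
  (* As k-1 differs from p, row i may be replaced by row k-1, where the comparison is an ascent or a
     descent. *)
  rewrite (sA i k.-1 k p) ?p_min //; try lia.
  by have := sD k.-1; rewrite prednK -/(a _) => [->|]; lia.
- move=> [p b] [p' b']; rewrite !inE /= => /and3P[_ _ bV] /and3P[_ _ bV'] H.
  have pp' : p = p'.
    apply/val_inj => /=; have := (ltn_ord p, ltn_ord p') => -[pl pl'].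
    (* If the positions differed, the comparison between them would say that each holds the smallest
       letter. *)
    case: (ltngtP p p') => // pp.
      have := H p p'; rewrite pp pl' /low_insertion_order /= !eqxx /=.
      by rewrite (gtn_eqF pp) => /(_ isT).
    have := H p' p; rewrite pp pl /low_insertion_order /= !eqxx /=.
    by rewrite (gtn_eqF pp) => /(_ isT).
  move: bV bV' H; rewrite -{}pp'; case: (boolP (0 < p < l.+1)) => /= [pl _ _ H|].
    have := H 0 p.+1; rewrite /low_insertion_order /= eqxx.
    have [-> ->] : (p.+1 == p) = false /\ (0 == p) = false by lia.
    by case/andP: pl => _ pl /(_ pl) /= ->.
  by move=> _ /negbTE-> /negbTE->.
Qed.

(** * Equality of the two generating functions *)

Lemma avoiders_small n : n < 2 -> avoiders n Pi_A = avoiders n Pi_S.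
Proof.
move=> n2; apply/setP => s; apply/avoiders_AP/avoiders_SP => _; lia.
Qed.

Lemma card_avoiders_Des n (D : {set 'I_n.-1}) :
  #|[set s in avoiders n Pi_S | Des s == D]| = #|[set s in avoiders n Pi_A | Des s == D]|.
Proof.
case: n D => [|[|l]] D; try by rewrite avoiders_small.
by rewrite card_avoiders_S card_avoiders_A (count_changes l (fun i => inord i \notin D)).
Qed.

Lemma Q_by_Des n (Pi : seq (seq nat)) m :
  Q n Pi m = (\sum_(D : {set 'I_n.-1}) F D m *+ #|[set s in avoiders n Pi | Des s == D]|)%R.
Proof.
rewrite /Q (partition_big (@Des n) xpredT) //=; apply: eq_bigr => D _.
rewrite -sum1dep_card -GRing.sumrMnr /=.
by apply: eq_bigr => s /andP[_ /eqP->].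
Qed.

Theorem proposition6p2 (n : nat) : Q n Pi_S = Q n Pi_A.
Proof.
apply: functional_extensionality => m; rewrite !Q_by_Des.
by apply: eq_bigr => D _; rewrite card_avoiders_Des.
Qed.
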